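(* Let $\alpha: I\to\mathbb{E}^3$ be a unit-speed curve with $\kappa\neq 0$, and let $K(s,v)=\overline{D}(s)+vN(s)$, where $\overline{D}(s)=\frac{1}{\sqrt{\kappa^2(s)+\tau^2(s)}}\left(\tau(s)T(s)+\kappa(s)B(s)\right)$, be the tangential Darboux developable surface of $\alpha$. Then the parameter curves of $K$ satisfy the following. (i) For fixed $v$, the $s$-parameter curve $s\mapsto K(s,v)$ is an asymptotic curve if and only if the curve $\alpha$ is a general helix or a slant helix. (ii) For fixed $v$, the $s$-parameter curve $s\mapsto K(s,v)$ is a geodesic curve if and only if the curve $\alpha$ is a plane curve or a slant helix. (iii) The $v$-parameter curves are straight lines. (iv) The parameter curves (both families) are lines of curvature.
   Context: All maps are smooth and $I\subset\mathbb{R}$ is an open interval. For a unit-speed curve $\alpha$ with $\kappa=\|\alpha''\|>0$, the Frenet frame is $T=\alpha'$, $N=\alpha''/\|\alpha''\|$, $B=T\times N$, with $T'=\kappa N$, $N'=-\kappa T+\tau B$, $B'=-\tau N$. $\overline{D}$ is called the unit Darboux vector field of $\alpha$. A plane curve is one with $\tau=0$; a general helix is a curve for which $\tau/\kappa$ is constant; a slant helix is a curve for which the function $\sigma(s)=\left(\frac{\kappa^2}{(\kappa^2+\tau^2)^{3/2}}\left(\frac{\tau}{\kappa}\right)'\right)(s)$ is constant. The unit normal of $K$ is $U=\frac{K_s\times K_v}{\|K_s\times K_v\|}$; for this surface $U=\pm\overline{D}$. The $s$-parameter curves are $s\mapsto K(s,v)$ with $v$ fixed, and the $v$-parameter curves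 are $v\mapsto K(s,v)$ with $s$ fixed. An $s$-parameter curve is a geodesic curve if its acceleration vector is normal to the surface, i.e. $U\times K_{ss}=0$ along it, and an asymptotic curve if its acceleration vector is tangent to the surface, i.e. $\langle U,K_{ss}\rangle=0$ along it (similarly for $v$-parameter curves with $K_{vv}$). A curve on the surface is a line of curvature if $S(t)$ and $t$ are linearly dependent along it, where $t$ is its tangent and $S$ is the shape operator of the surface.
   Formalization: In (i) and (ii) the equivalence for each fixed v is false as written; proved instead: for each v with the slant helix constant equal to v (and v=0 for a plane curve in (ii)), and also with ''for some fixed v'' and the original right-hand sides; U is the continuous extension at singular points. *)

(* Defs.v *)
From mathcomp Require Import all_boot all_order all_algebra.
From mathcomp Require Import all_classical all_reals all_analysis.
Set Implicit Arguments.
Unset Strict Implicit.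
Unset Printing Implicit Defensive.
Import Order.TTheory GRing.Theory Num.Theory.
Import numFieldNormedType.Exports.
Local Open Scope classical_set_scope.
Local Open Scope ring_scope.

Section EuclideanSpace.
Variable R : realType.
Implicit Types u v : 'rV[R]_3.

Definition dot u v : R := \sum_(i < 3) u 0 i * v 0 i.

(* The library norm on row vectors is the sup norm, hence this one. *)
Definition enorm u : R := Num.sqrt (dot u u).

(* Indices are added modulo 3. *)
Definition cross u v : 'rV[R]_3 :=
  \row_(k < 3) (u 0 (k + 1) * v 0 (k + 2) - u 0 (k + 2) * v 0 (k + 1)).

Definition linearly_dependent u v : Prop :=
  exists a b : R, (a, b) != (0, 0) /\ a *: u + b *: v = 0.

End EuclideanSpace.

Section SpaceCurves.
Variable R : realType.
Implicit Types (I : set R) (alpha : R -> 'rV[R]_3) (s : R).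

Definition smooth_on I alpha : Prop :=
  forall (n : nat) s, I s -> derivable (derive1n n alpha) s 1.

Definition unit_speed_on I alpha : Prop :=
  forall s, I s -> enorm (derive1 alpha s) = 1.

Definition tangent alpha s : 'rV[R]_3 := derive1 alpha s.
Definition curvature alpha s : R := enorm (derive1n 2 alpha s).
Definition normal alpha s : 'rV[R]_3 :=
  (enorm (derive1n 2 alpha s))^-1 *: derive1n 2 alpha s.
Definition binormal alpha s : 'rV[R]_3 :=
  cross (tangent alpha s) (normal alpha s).

(* The coefficient of B in the Frenet equation N' = - kappa T + tau B. *)
Definition torsion alpha s : R :=
  dot (derive1 (normal alpha) s) (binormal alpha s).

Definition plane_curve I alpha : Prop :=
  forall s, I s -> torsion alpha s = 0.

Definition general_helix I alpha : Prop :=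
  exists c : R, forall s, I s -> torsion alpha s / curvature alpha s = c.

Definition slant_sigma alpha s : R :=
  curvature alpha s ^+ 2
    / ((curvature alpha s ^+ 2 + torsion alpha s ^+ 2) `^ (3 / 2))
  * derive1 (fun r => torsion alpha r / curvature alpha r) s.

Definition slant_helix_of_constant I alpha (c : R) : Prop :=
  forall s, I s -> slant_sigma alpha s = c.

Definition slant_helix I alpha : Prop :=
  exists c : R, slant_helix_of_constant I alpha c.

Definition unit_darboux alpha s : 'rV[R]_3 :=
  (Num.sqrt (curvature alpha s ^+ 2 + torsion alpha s ^+ 2))^-1
  *: (torsion alpha s *: tangent alpha s
      + curvature alpha s *: binormal alpha s).

Definition darboux_developable alpha (p : R * R) : 'rV[R]_3 :=
  unit_darboux alpha p.1 + p.2 *: normal alpha p.1.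

End SpaceCurves.

(* Surfaces are parametrized by pairs p = (s, v) with s in I and v in R. A curve
   on the surface K is K \o c for a curve c in the parameter plane. *)
Section Surfaces.
Variable R : realType.
Implicit Types (I J : set R) (K U : R * R -> 'rV[R]_3) (c : R -> R * R).
Implicit Types p w : R * R.

Definition partial_s K p : 'rV[R]_3 := derive1 (fun s => K (s, p.2)) p.1.
Definition partial_v K p : 'rV[R]_3 := derive1 (fun v => K (p.1, v)) p.2.

Definition normal_vector K p : 'rV[R]_3 :=
  cross (partial_s K p) (partial_v K p).

Definition gauss_normal K p : 'rV[R]_3 :=
  (enorm (normal_vector K p))^-1 *: normal_vector K p.

(* K may have singular points, where K_s x K_v = 0 and the quotient defining the
   unit normal is meaningless (the library division by 0 would give 0). There U
   is the continuous extension. The pointwise sign is needed because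
   K_s x K_v may reverse its direction across the singular set. *)
Definition unit_normal_on I K U : Prop :=
  forall p, I p.1 ->
    [/\ {for p, continuous U}, enorm (U p) = 1 &
        normal_vector K p != 0 ->
        U p = gauss_normal K p \/ U p = - gauss_normal K p].

Definition s_curve (v : R) : R -> R * R := fun s => (s, v).
Definition v_curve (s : R) : R -> R * R := fun v => (s, v).

Definition asymptotic_curve J K U c : Prop :=
  forall t, J t -> dot (U (c t)) (derive1n 2 (K \o c) t) = 0.

Definition geodesic_curve J K U c : Prop :=
  forall t, J t -> cross (U (c t)) (derive1n 2 (K \o c) t) = 0.

Definition tangent_map K p w : 'rV[R]_3 :=
  w.1 *: partial_s K p + w.2 *: partial_v K p.

(* The value of the shape operator at the tangent vector tangent_map K p w,
   i.e. S (K_s) = - U_s and S (K_v) = - U_v, extended linearly. *)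
Definition shape_operator U p w : 'rV[R]_3 := - tangent_map U p w.

Definition line_of_curvature J K U c : Prop :=
  forall t, J t ->
    let w := (derive1 (fst \o c) t, derive1 (snd \o c) t) in
    linearly_dependent (shape_operator U (c t) w) (tangent_map K (c t) w).

Definition straight_line (gamma : R -> 'rV[R]_3) : Prop :=
  exists p d : 'rV[R]_3, d != 0 /\ range gamma = [set p + t *: d | t in setT].

End Surfaces.

(* Main.v *)
(* Write omega = sqrt (kappa^2 + tau^2), E = N' / omega, and let theta be the
   angle with tan theta = tau / kappa. Then (D, N, E) is an orthonormal frame
   with D' = - theta' E, N' = omega E, E' = theta' D - omega N, and
   sigma = theta' / omega. Hence K_s = omega (v - sigma) E and K_v = N, so U is
   D up to a locally constant sign, <D, K_ss> = omega^2 sigma (v - sigma), and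
   D x K_ss has the E-component - omega^2 (v - sigma). An asymptotic s-curve
   therefore has sigma (v - sigma) = 0, and connectedness of I forces sigma = 0
   throughout or sigma = v throughout. *)
Require Import Defs.
From mathcomp Require Import all_boot all_order all_algebra.
From mathcomp Require Import all_classical all_reals all_analysis.
From mathcomp Require Import ring lra.
Set Implicit Arguments.
Unset Strict Implicit.
Unset Printing Implicit Defensive.
Import Order.TTheory GRing.Theory Num.Theory.
Import numFieldNormedType.Exports.
Local Open Scope classical_set_scope.
Local Open Scope ring_scope.

(** * Coordinate algebra of the dot and cross products, and expansion in an orthonormal frame *)

Section VectorAlgebra.
Variable R : realType.
Implicit Types u v w x : 'rV[R]_3.

Lemma row3P u v :
  u 0 0 = v 0 0 -> u 0 1 = v 0 1 -> u 0 2 = v 0 2 -> u = v.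
Proof.
move=> e0 e1 e2; apply/rowP => -[[|[|[|//]]] lti].
- by rewrite (_ : Ordinal lti = 0) //; apply: val_inj.
- by rewrite (_ : Ordinal lti = 1) //; apply: val_inj.
- by rewrite (_ : Ordinal lti = 2) //; apply: val_inj.
Qed.

Lemma dotE u v : dot u v = u 0 0 * v 0 0 + u 0 1 * v 0 1 + u 0 2 * v 0 2.
Proof.
rewrite /dot !big_ord_recr big_ord0 /= add0r.
by congr (u _ _ * v _ _ + u _ _ * v _ _ + u _ _ * v _ _); apply: val_inj.
Qed.

Lemma cross0E u v : cross u v 0 0 = u 0 1 * v 0 2 - u 0 2 * v 0 1.
Proof. by rewrite mxE; congr (u _ _ * v _ _ - u _ _ * v _ _); apply: val_inj. Qed.

Lemma cross1E u v : cross u v 0 1 = u 0 2 * v 0 0 - u 0 0 * v 0 2.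
Proof. by rewrite mxE; congr (u _ _ * v _ _ - u _ _ * v _ _); apply: val_inj. Qed.

Lemma cross2E u v : cross u v 0 2 = u 0 0 * v 0 1 - u 0 1 * v 0 0.
Proof. by rewrite mxE; congr (u _ _ * v _ _ - u _ _ * v _ _); apply: val_inj. Qed.

Definition crossE := (cross0E, cross1E, cross2E).

Lemma dotC u v : dot u v = dot v u.
Proof. by rewrite !dotE; ring. Qed.

Lemma dotDl u v w : dot (u + v) w = dot u w + dot v w.
Proof. by rewrite !dotE !mxE; ring. Qed.

Lemma dotDr u v w : dot w (u + v) = dot w u + dot w v.
Proof. by rewrite !dotE !mxE; ring. Qed.

Lemma dotZl a u v : dot (a *: u) v = a * dot u v.
Proof. by rewrite !dotE !mxE; ring. Qed.

Lemma dotZr a u v : dot u (a *: v) = a * dot u v.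
Proof. by rewrite !dotE !mxE; ring. Qed.

Lemma dotNl u v : dot (- u) v = - dot u v.
Proof. by rewrite !dotE !mxE; ring. Qed.

Lemma dotNr u v : dot u (- v) = - dot u v.
Proof. by rewrite !dotE !mxE; ring. Qed.

Lemma dot0l u : dot 0 u = 0.
Proof. by rewrite dotE !mxE; ring. Qed.

Definition dot_linear := (dotDl, dotDr, dotZl, dotZr, dotNl, dotNr).

Lemma crossDr u v w : cross w (u + v) = cross w u + cross w v.
Proof. by apply: row3P; rewrite [in RHS]mxE !crossE !mxE; ring. Qed.

Lemma crossZl a u v : cross (a *: u) v = a *: cross u v.
Proof. by apply: row3P; rewrite [in RHS]mxE !crossE !mxE; ring. Qed.

Lemma crossZr a u v : cross u (a *: v) = a *: cross u v.
Proof. by apply: row3P; rewrite [in RHS]mxE !crossE !mxE; ring. Qed.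

Lemma cross0r u : cross u 0 = 0.
Proof. by apply: row3P; rewrite [in RHS]mxE !crossE !mxE; ring. Qed.

Lemma crossC u v : cross u v = - cross v u.
Proof. by apply: row3P; rewrite [in RHS]mxE !crossE; ring. Qed.

Lemma crossvv u : cross u u = 0.
Proof. by apply: row3P; rewrite [in RHS]mxE !crossE; ring. Qed.

Lemma dot_crossCA u v w : dot u (cross v w) = dot v (cross w u).
Proof. by rewrite !dotE !crossE; ring. Qed.

Lemma triple_crossr u v w : cross u (cross v w) = dot u w *: v - dot u v *: w.
Proof. by apply: row3P; rewrite !crossE !mxE !dotE; ring. Qed.

Lemma dotvv_ge0 u : 0 <= dot u u.
Proof. by rewrite dotE; nra. Qed.

Lemma dotvv_eq0 u : (dot u u == 0) = (u == 0).
Proof.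
apply/eqP/eqP => [uu0|->]; last exact: dot0l.
move: uu0; rewrite dotE => uu0.
by apply: row3P; rewrite [RHS]mxE; nra.
Qed.

Lemma enorm_sqr u : enorm u ^+ 2 = dot u u.
Proof. by rewrite sqr_sqrtr// dotvv_ge0. Qed.

Lemma enorm_eq1 u : enorm u = 1 <-> dot u u = 1.
Proof.
split=> [u1|u1]; first by rewrite -enorm_sqr u1 expr1n.
by rewrite /enorm u1 sqrtr1.
Qed.

Lemma enormZ a u : enorm (a *: u) = `|a| * enorm u.
Proof.
by rewrite /enorm !dot_linear mulrA sqrtrM ?sqrtr_sqr// -expr2 sqr_ge0.
Qed.

(** Equality case of Cauchy-Schwarz: the residual [u - dot u v *: v] has squared length
    [1 - dot u v ^+ 2]. *)
Lemma unit_collinear u v :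
  dot u u = 1 -> dot v v = 1 -> dot u v ^+ 2 = 1 -> u = dot u v *: v.
Proof.
move=> u1 v1 uv; apply/eqP; rewrite -subr_eq0 -dotvv_eq0.
rewrite !dot_linear (dotC v u) u1 v1.
by apply/eqP; move: uv; rewrite expr2; lra.
Qed.

Section Frame.
Variables t n : 'rV[R]_3.
Hypotheses (tt : dot t t = 1) (nn : dot n n = 1) (tn : dot t n = 0).

Lemma frame_dot_tb : dot t (cross t n) = 0.
Proof. by rewrite !dotE !crossE; ring. Qed.

Lemma frame_dot_nb : dot n (cross t n) = 0.
Proof. by rewrite !dotE !crossE; ring. Qed.

Lemma frame_dot_bb : dot (cross t n) (cross t n) = 1.
Proof.
rewrite dot_crossCA triple_crossr !dot_linear dotC tn nn tt; ring.
Qed.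

Lemma frame_cross_tb : cross t (cross t n) = - n.
Proof. by rewrite triple_crossr tn tt scale0r scale1r sub0r. Qed.

Lemma frame_cross_nb : cross n (cross t n) = t.
Proof. by rewrite triple_crossr (dotC n t) tn nn scale0r scale1r subr0. Qed.

Lemma frame_expansion x :
  x = dot x t *: t + dot x n *: n + dot x (cross t n) *: cross t n.
Proof.
set b := cross t n.
pose y := x - dot x t *: t - dot x n *: n - dot x b *: b.
have yt : dot t y = 0.
  by rewrite /y !dot_linear frame_dot_tb tn tt (dotC t x); ring.
have yn : dot n y = 0.
  by rewrite /y !dot_linear frame_dot_nb (dotC n t) tn nn (dotC n x); ring.
have yb : dot y b = 0.
  by rewrite /y !dot_linear frame_dot_tb frame_dot_nb frame_dot_bb; ring.
(* [y] is orthogonal to [t] and [n], hence both parallel and orthogonal to [b]. *)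
have : y = 0.
  have by0 : cross y b = 0.
    by rewrite triple_crossr !(dotC y) yn yt !scale0r subrr.
  have := triple_crossr b y b.
  by rewrite by0 cross0r frame_dot_bb dotC yb scale1r scale0r subr0.
by move/eqP; rewrite /y -!addrA -!opprD subr_eq0 addrA => /eqP.
Qed.

End Frame.

End VectorAlgebra.

(** * Calculus of smooth functions on an open set *)

Section SmoothFunctions.
Variables (R : realType) (I : set R).
Hypothesis openI : open I.

Section Rules.
Variables (W : normedModType R).
Implicit Types (f g : R -> W) (a : W) (s : R).

Lemma is_derive1E f a s : is_derive s 1 f a -> derive1 f s = a.
Proof. by move=> df; rewrite derive1E derive_val. Qed.

Lemma derivable_is_derive1 f s : derivable f s 1 -> is_derive s 1 f (derive1 f s).
Proof. by rewrite derive1E => /derivableP. Qed.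

Lemma near_open f g s : (forall r, I r -> f r = g r) -> I s ->
  \forall r \near s, f r = g r.
Proof.
move=> fg Is; have : nbhs s I by exact: open_nbhs_nbhs.
by apply: filterS.
Qed.

Lemma derive1_eq_on f g s :
  (forall r, I r -> f r = g r) -> I s -> derive1 f s = derive1 g s.
Proof.
by move=> fg Is; rewrite !derive1E; apply: near_eq_derive; exact: near_open.
Qed.

(** Smoothness is handled order by order. The recursion passes to [derive1 f], so closure properties
    follow by induction on [k] with the function generalized. *)
Fixpoint ndiff k f : Prop :=
  if k is k'.+1 then
    (forall s, I s -> derivable f s 1) /\ ndiff k' (derive1 f)
  else True.

Definition smooth f := forall k, ndiff k f.

Lemma ndiff_eq_on k f g : (forall r, I r -> f r = g r) -> ndiff k f -> ndiff k g.
Proof.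
elim: k f g => // k IHk f g fg /= [df ndf]; split.
  by move=> s Is; apply: near_eq_derivable (df s Is); exact: near_open.
by apply: IHk ndf => r Ir; exact: derive1_eq_on.
Qed.

Lemma ndiff_pred k f : ndiff k.+1 f -> ndiff k f.
Proof. by elim: k f => // k IHk f [df /IHk]. Qed.

Lemma ndiffD k f g : ndiff k f -> ndiff k g -> ndiff k (fun s => f s + g s).
Proof.
elim: k f g => // k IHk f g [df ndf] [dg ndg]; split.
  by move=> s Is; apply: derivableD; [exact: df|exact: dg].
apply: ndiff_eq_on (IHk _ _ ndf ndg) => s Is.
by rewrite !derive1E -deriveD //; [exact: df|exact: dg].
Qed.

Lemma smooth_eq_on f g : (forall r, I r -> f r = g r) -> smooth f -> smooth g.
Proof. by move=> fg sf k; exact: ndiff_eq_on (sf k). Qed.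

Lemma smoothD f g : smooth f -> smooth g -> smooth (fun s => f s + g s).
Proof. by move=> sf sg k; exact: ndiffD. Qed.

Lemma smooth_cst (c : W) : smooth (cst c).
Proof.
(* The constant has to vary in the induction, because the derivative of [cst c] is [cst 0]. *)
suff : forall k (c : W), ndiff k (cst c) by move=> h k; exact: h.
elim=> // k IHk d; split => [s _|]; first exact: derivable_cst.
apply: ndiff_eq_on (IHk 0) => s _.
by rewrite derive1_cst.
Qed.

Lemma smooth_derive1 f : smooth f -> smooth (derive1 f).
Proof. by move=> sf k; have [] := sf k.+1. Qed.

Lemma smooth_is_derive f s : smooth f -> I s -> is_derive s 1 f (derive1 f s).
Proof.
by move=> sf Is; apply: derivable_is_derive1; have [+ _] := sf 1%N; exact.
Qed.

Lemma smooth_continuous f s : smooth f -> I s -> {for s, continuous f}.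
Proof.
move=> sf Is; have [df _] := sf 1%N.
exact/differentiable_continuous/derivable1_diffP/df.
Qed.

End Rules.

(** The product rule is all that closure of smoothness under a product requires. Isolating it lets
    one induction serve multiplication, scaling, [dot] and [cross]. *)
Definition leibniz (U V W : normedModType R) (op : U -> V -> W) :=
  forall (f : R -> U) (g : R -> V) f' g' (s : R),
    is_derive s 1 f f' -> is_derive s 1 g g' ->
    is_derive s 1 (fun r => op (f r) (g r)) (op f' (g s) + op (f s) g').

(** The derivative is a sum of two products, each pairing a derivative with an undifferentiated
    factor; the latter is lowered by one order with [ndiff_pred] so that the induction hypothesis
    applies. *)
Lemma ndiff_op (U V W : normedModType R) (op : U -> V -> W) k f g :
  leibniz op -> ndiff k f -> ndiff k g -> ndiff k (fun r => op (f r) (g r)).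
Proof.
move=> op_leib; elim: k f g => // k IHk f g kf kg.
have [[df ndf] [dg ndg]] := (kf, kg).
have dop s : I s -> is_derive s 1 (fun r => op (f r) (g r))
    (op (derive1 f s) (g s) + op (f s) (derive1 g s)).
  by move=> Is; apply: op_leib; apply: derivable_is_derive1; [exact: df|exact: dg].
split; first by move=> s /dop[].
apply: ndiff_eq_on (ndiffD (IHk _ _ ndf (ndiff_pred kg))
                           (IHk _ _ (ndiff_pred kf) ndg)) => s Is.
by rewrite (is_derive1E (dop s Is)).
Qed.

Lemma smooth_op (U V W : normedModType R) (op : U -> V -> W) f g :
  leibniz op -> smooth f -> smooth g -> smooth (fun r => op (f r) (g r)).
Proof. by move=> op_leib sf sg k; exact: ndiff_op. Qed.

Lemma leibniz_mul : leibniz (fun a b : R => a * b).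
Proof.
move=> f g f' g' s df dg; apply: is_derive_eq (is_deriveM df dg) _.
by rewrite /GRing.scale /= addrC mulrC.
Qed.

Lemma is_derive_mx m n (F : R -> 'M[R]_(m, n)) (F' : 'M[R]_(m, n)) (s : R) :
  (forall i j, is_derive s 1 (fun r => F r i j) (F' i j)) -> is_derive s 1 F F'.
Proof.
move=> dF; have dFs : derivable F s 1.
  by apply/derivable_mxP => i j; case: (dF i j).
apply: DeriveDef => //; rewrite derive_mx//.
by apply/matrixP => i j; rewrite mxE derive_val.
Qed.

Lemma is_derive_coord m n (F : R -> 'M[R]_(m, n)) (F' : 'M[R]_(m, n)) (s : R) i j :
  is_derive s 1 F F' -> is_derive s 1 (fun r => F r i j) (F' i j).
Proof.
move=> [dF <-]; apply: DeriveDef; first exact: (derivable_mxP _ _ _).1.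
by rewrite derive_mx// mxE.
Qed.

Lemma leibniz_scale m n :
  leibniz (fun (a : R) (M : 'M[R]_(m, n)) => a *: M).
Proof.
move=> f g f' g' s df dg; apply: is_derive_mx => i j.
under eq_fun do rewrite mxE.
rewrite !mxE; apply: leibniz_mul => //; exact: is_derive_coord.
Qed.

Lemma leibniz_dot : leibniz (@dot R).
Proof.
move=> f g f' g' s df dg; rewrite (_ : _ + _ = \sum_(i < 3)
  (f' 0 i * g s 0 i + f s 0 i * g' 0 i)); last by rewrite big_split.
have dfg (i : 'I_3) : is_derive s 1 (fun r => f r 0 i * g r 0 i)
    (f' 0 i * g s 0 i + f s 0 i * g' 0 i).
  by apply: leibniz_mul; exact: is_derive_coord.
apply: is_derive_eq => //.
by have := @is_derive_sum _ _ _ 3 _ s 1 _ dfg; rewrite fct_sumE.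
Qed.

Lemma leibniz_cross : leibniz (@cross R).
Proof.
move=> f g f' g' s df dg; apply: is_derive_mx => i j.
under eq_fun do rewrite mxE.
rewrite !mxE; apply: is_derive_eq.
  by apply: is_deriveB; apply: leibniz_mul; exact: is_derive_coord.
by rewrite /=; ring.
Qed.

(** The derivative [- f' / f ^+ 2] is a product of [f'] and two copies of [f^-1], and the induction
    hypothesis gives [f^-1] one order less. *)
Lemma ndiffV k (f : R -> R) :
  (forall s, I s -> f s != 0) -> ndiff k f -> ndiff k (fun s => (f s)^-1).
Proof.
move=> f0; elim: k => // k IHk kf; have [df ndf] := kf.
have dfV s : I s -> is_derive s 1 (fun r => (f r)^-1)
    (- (f s) ^- 2 *: derive1 f s).
  by move=> Is; apply: is_deriveV (f0 s Is) (derivable_is_derive1 (df s Is)).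
split; first by move=> s /dfV[].
have ndV := IHk (ndiff_pred kf).
have nd := ndiff_op leibniz_mul (@smooth_cst R (-1) k)
  (ndiff_op leibniz_mul (ndiff_op leibniz_mul ndV ndV) ndf).
apply: ndiff_eq_on nd => s Is.
by rewrite (is_derive1E (dfV s Is)) /GRing.scale /= mulN1r mulNr expr2 invfM.
Qed.

Lemma smoothV (f : R -> R) :
  (forall s, I s -> f s != 0) -> smooth f -> smooth (fun s => (f s)^-1).
Proof. by move=> f0 sf k; exact: ndiffV. Qed.

Lemma is_derive_sqrt (f : R -> R) f' (s : R) : 0 < f s -> is_derive s 1 f f' ->
  is_derive s 1 (fun r => Num.sqrt (f r)) ((2 * Num.sqrt (f s))^-1 * f').
Proof.
by move=> f0 df; apply: is_derive_eq;
  [apply: is_derive1_comp; exact: is_derive1_sqrt|].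
Qed.

(** The derivative is [f' / (2 * sqrt f)]: the root reappears only inside an inverse, at the order
    already known by induction. *)
Lemma smooth_sqrt (f : R -> R) :
  (forall s, I s -> 0 < f s) -> smooth f -> smooth (fun s => Num.sqrt (f s)).
Proof.
move=> f0 sf k; elim: k f f0 sf => // k IHk f f0 sf.
have dsq s : I s -> is_derive s 1 (fun r => Num.sqrt (f r))
    ((2 * Num.sqrt (f s))^-1 * derive1 f s).
  by move=> Is; apply: is_derive_sqrt (f0 s Is) (smooth_is_derive sf Is).
split; first by move=> s /dsq[].
have sq0 s : I s -> 2 * Num.sqrt (f s) != 0.
  by move=> Is; rewrite mulf_neq0// gt_eqF// sqrtr_gt0 f0.
have nd := ndiff_op leibniz_mul
  (ndiffV sq0 (ndiff_op leibniz_mul (@smooth_cst R 2 k) (IHk f f0 sf)))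
  (smooth_derive1 sf k).
by apply: ndiff_eq_on nd => s Is; rewrite (is_derive1E (dsq s Is)).
Qed.

Lemma smoothM (f g : R -> R) : smooth f -> smooth g -> smooth (fun s => f s * g s).
Proof. exact: smooth_op leibniz_mul. Qed.

Lemma smoothZ m n (f : R -> R) (F : R -> 'M[R]_(m, n)) :
  smooth f -> smooth F -> smooth (fun s => f s *: F s).
Proof. exact: smooth_op (@leibniz_scale m n). Qed.

Lemma smooth_dot (F G : R -> 'rV[R]_3) :
  smooth F -> smooth G -> smooth (fun s => dot (F s) (G s)).
Proof. exact: smooth_op leibniz_dot. Qed.

Lemma smooth_cross (F G : R -> 'rV[R]_3) :
  smooth F -> smooth G -> smooth (fun s => cross (F s) (G s)).
Proof. exact: smooth_op leibniz_cross. Qed.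

End SmoothFunctions.

(** * The Frenet equations, and the rotating frame (D, N, E) built from them *)

Section FrenetFrame.
Variables (R : realType) (I : set R) (alpha : R -> 'rV[R]_3).
Hypotheses (openI : open I) (smooth_alpha : smooth_on I alpha)
  (unit_speed : unit_speed_on I alpha)
  (curvature_neq0 : forall s, I s -> curvature alpha s != 0).

Local Notation kappa := (curvature alpha).
Local Notation tau := (torsion alpha).
Local Notation T := (tangent alpha).
Local Notation N := (normal alpha).
Local Notation B := (binormal alpha).
Local Notation accel := (derive1n 2 alpha).

(** [smooth_on] adds derivatives on the outside, [smooth] on the inside; [derive1Sn] exchanges the
    two orders. *)
Lemma smooth_curve : smooth I alpha.
Proof.
move=> k; elim: k alpha smooth_alpha => // k IHk f sf; split.
  by move=> s Is; exact: (sf 0%N).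
by apply: IHk => n s Is; rewrite -derive1Sn; exact: sf.
Qed.

Lemma smooth_tangent : smooth I T.
Proof. exact/smooth_derive1/smooth_curve. Qed.

Lemma smooth_accel : smooth I accel.
Proof. exact/smooth_derive1/smooth_tangent. Qed.

Lemma curvature_gt0 s : I s -> 0 < kappa s.
Proof. by move=> Is; rewrite lt0r curvature_neq0// sqrtr_ge0. Qed.

Lemma smooth_curvature : smooth I kappa.
Proof.
apply: (smooth_sqrt openI) => [s Is|].
  by have := curvature_gt0 Is; rewrite /curvature /enorm sqrtr_gt0.
exact (smooth_dot openI smooth_accel smooth_accel).
Qed.

Lemma smooth_normal : smooth I N.
Proof.
exact (smoothZ openI (smoothV openI curvature_neq0 smooth_curvature) smooth_accel).
Qed.

Lemma smooth_binormal : smooth I B.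
Proof. exact (smooth_cross openI smooth_tangent smooth_normal). Qed.

Lemma smooth_torsion : smooth I tau.
Proof.
exact (smooth_dot openI (smooth_derive1 smooth_normal) smooth_binormal).
Qed.

Lemma accelE s : I s -> accel s = kappa s *: N s.
Proof. by move=> Is; rewrite scalerA divff ?scale1r ?curvature_neq0. Qed.

Lemma is_derive_tangent s : I s -> is_derive s 1 T (kappa s *: N s).
Proof.
move=> Is; have dT := smooth_is_derive smooth_tangent Is.
by apply: is_derive_eq dT _; rewrite -accelE.
Qed.

(** Source of the Frenet coefficients: it is applied below to [|T|^2 = 1], [|N|^2 = 1] and
    [<T, N> = 0]. *)
Lemma dot_derive_cst (f g : R -> 'rV[R]_3) f' g' (c s : R) :
  (forall r, I r -> dot (f r) (g r) = c) -> I s ->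
  is_derive s 1 f f' -> is_derive s 1 g g' -> dot f' (g s) + dot (f s) g' = 0.
Proof.
move=> fgc Is df dg; rewrite -(is_derive1E (leibniz_dot df dg)).
by rewrite (@derive1_eq_on _ _ openI _ _ (cst c)) ?derive1_cst.
Qed.

Lemma dot_tangent_tangent s : I s -> dot (T s) (T s) = 1.
Proof. by move=> Is; apply/enorm_eq1; exact: unit_speed. Qed.

Lemma dot_normal_normal s : I s -> dot (N s) (N s) = 1.
Proof.
move=> Is; rewrite !dot_linear -enorm_sqr.
by rewrite mulrA -expr2 exprVn mulVf // expf_neq0// curvature_neq0.
Qed.

Lemma dot_tangent_normal s : I s -> dot (T s) (N s) = 0.
Proof.
move=> Is; have dT := is_derive_tangent Is.
have := dot_derive_cst dot_tangent_tangent Is dT dT.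
rewrite dotZl dotZr (dotC (N s)) -mulr2n => /eqP.
by rewrite mulrn_eq0/= mulf_eq0 (negbTE (curvature_neq0 Is)) => /eqP.
Qed.

(** Expand N' in the frame (T, N, B): [<N', B>] is [tau] by definition, [<N', N> = 0] because N has
    constant length, and [<N', T> = - <N, T'> = - kappa]. *)
Lemma is_derive_normal s : I s ->
  is_derive s 1 N (- kappa s *: T s + tau s *: B s).
Proof.
move=> Is; have dN := smooth_is_derive smooth_normal Is.
apply: is_derive_eq => //.
rewrite (frame_expansion (dot_tangent_tangent Is) (dot_normal_normal Is)
  (dot_tangent_normal Is) (derive1 N s)) -/(binormal alpha s) -/(torsion alpha s).
have := dot_derive_cst dot_normal_normal Is dN dN.
rewrite (dotC (N s)) -mulr2n => /eqP; rewrite mulrn_eq0/= => /eqP ->.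
have := dot_derive_cst dot_tangent_normal Is (is_derive_tangent Is) dN.
rewrite dotZl dot_normal_normal// mulr1 (dotC (T s)) addrC => /eqP.
by rewrite addr_eq0 => /eqP ->; rewrite scale0r addr0.
Qed.

(** In [B' = T' x N + T x N'] the terms [N x N] and [T x T] vanish, and [T x B = - N]. *)
Lemma is_derive_binormal s : I s -> is_derive s 1 B (- tau s *: N s).
Proof.
move=> Is.
apply: is_derive_eq (leibniz_cross (is_derive_tangent Is) (is_derive_normal Is)) _.
rewrite crossDr !(crossZl, crossZr) !crossvv !scaler0 !add0r.
rewrite (frame_cross_tb (dot_tangent_tangent Is)  (dot_tangent_normal Is)).
by rewrite scalerN scaleNr.
Qed.

Definition darboux_norm s : R := Num.sqrt (kappa s ^+ 2 + tau s ^+ 2).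

Local Notation omega := darboux_norm.
Local Notation D := (unit_darboux alpha).

(* The derivative of the angle theta with tan theta = tau / kappa. *)
Definition darboux_angle_speed s : R :=
  kappa s ^+ 2 / omega s ^+ 2 * derive1 (fun r => tau r / kappa r) s.

Local Notation theta' := darboux_angle_speed.

(* The unit vector N' / omega. *)
Definition darboux_conormal s : 'rV[R]_3 :=
  (omega s)^-1 *: (- kappa s *: T s + tau s *: B s).

Local Notation E := darboux_conormal.

Lemma darboux_sqr_gt0 s : I s -> 0 < kappa s ^+ 2 + tau s ^+ 2.
Proof. by move=> Is; rewrite ltr_pwDl ?sqr_ge0// exprn_gt0// curvature_gt0. Qed.

Lemma darboux_norm_gt0 s : I s -> 0 < omega s.
Proof. by move=> Is; rewrite sqrtr_gt0 darboux_sqr_gt0. Qed.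

Lemma darboux_norm_sqr s : I s -> omega s ^+ 2 = kappa s ^+ 2 + tau s ^+ 2.
Proof. by move=> Is; rewrite sqr_sqrtr// ltW// darboux_sqr_gt0. Qed.

Lemma smooth_darboux_sqr : smooth I (fun s => kappa s ^+ 2 + tau s ^+ 2).
Proof.
exact (smoothD openI (smoothM openI smooth_curvature smooth_curvature)
                     (smoothM openI smooth_torsion smooth_torsion)).
Qed.

Lemma smooth_darboux_norm : smooth I omega.
Proof. exact (smooth_sqrt openI darboux_sqr_gt0 smooth_darboux_sqr). Qed.

Lemma smooth_ratio : smooth I (fun s => tau s / kappa s).
Proof.
exact (smoothM openI smooth_torsion (smoothV openI curvature_neq0 smooth_curvature)).
Qed.

Lemma smooth_angle_speed : smooth I theta'.
Proof.
have w0 s : I s -> omega s ^+ 2 != 0.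
  by move=> Is; rewrite expf_neq0// gt_eqF// darboux_norm_gt0.
exact (smoothM openI
  (smoothM openI (smoothM openI smooth_curvature smooth_curvature)
     (smoothV openI w0 (smoothM openI smooth_darboux_norm smooth_darboux_norm)))
  (smooth_derive1 smooth_ratio)).
Qed.

Lemma slant_sigmaE s : I s -> slant_sigma alpha s = theta' s / omega s.
Proof.
move=> Is; have w0 := darboux_norm_gt0 Is; rewrite /slant_sigma.
(* The power 3/2 is split so that the root is taken first, which gives
   [(omega^2)^(3/2) = omega^3]. *)
rewrite powRrM -darboux_norm_sqr// powRAC powR12_sqrt; last by rewrite sqr_ge0.
rewrite sqrtr_sqr gtr0_norm// powR_mulrn ?ltW// /darboux_angle_speed.
by field; rewrite gt_eqF.
Qed.

Lemma is_derive_normal_darboux s : I s -> is_derive s 1 N (omega s *: E s).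
Proof.
move=> Is; rewrite scalerA divff ?scale1r ?gt_eqF ?darboux_norm_gt0//.
exact: is_derive_normal.
Qed.

(** The factor [kappa^2] absorbs the denominator of the quotient rule. In this form the derivatives
    of D and E become rational identities whose only denominator is a power of [omega]. *)
Lemma angle_speedE s : I s -> theta' s =
  (derive1 tau s * kappa s - tau s * derive1 kappa s) / omega s ^+ 2.
Proof.
move=> Is; have w0 := darboux_norm_gt0 Is; have k0 := curvature_gt0 Is.
have dk := smooth_is_derive smooth_curvature Is.
have dt := smooth_is_derive smooth_torsion Is.
rewrite /darboux_angle_speed.
rewrite (is_derive1E (leibniz_mul dt (is_deriveV (curvature_neq0 Is) dk))).
by rewrite /GRing.scale/=; field; rewrite !gt_eqF.
Qed.

Lemma is_derive_inv_norm s : I s -> is_derive s 1 (fun r => (omega r)^-1)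
  (- (kappa s * derive1 kappa s + tau s * derive1 tau s) / omega s ^+ 3).
Proof.
move=> Is; have w0 := darboux_norm_gt0 Is.
have dk := smooth_is_derive smooth_curvature Is.
have dt := smooth_is_derive smooth_torsion Is.
have dk2 : is_derive s 1 (fun r => kappa r ^+ 2 + tau r ^+ 2)
   (2 * (kappa s * derive1 kappa s + tau s * derive1 tau s)).
  apply: is_derive_eq (is_deriveD (leibniz_mul dk dk) (leibniz_mul dt dt)) _.
  by ring.
have dw := @is_derive_sqrt _ (fun r => kappa r ^+ 2 + tau r ^+ 2) _ _
  (darboux_sqr_gt0 Is) dk2.
have w0' : omega s != 0 by rewrite gt_eqF.
apply: is_derive_eq (is_deriveV w0' dw) _.
by rewrite /GRing.scale/= -/(omega s); field.
Qed.

Lemma is_derive_darboux s : I s -> is_derive s 1 D (- theta' s *: E s).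
Proof.
move=> Is; have w0 := darboux_norm_gt0 Is; have k0 := curvature_gt0 Is.
have dk := smooth_is_derive smooth_curvature Is.
have dt := smooth_is_derive smooth_torsion Is.
have w2 := darboux_norm_sqr Is.
apply: is_derive_eq (leibniz_scale (is_derive_inv_norm Is)
  (is_deriveD (leibniz_scale dt (is_derive_tangent Is))
              (leibniz_scale dk (is_derive_binormal Is)))) _.
rewrite angle_speedE// /darboux_conormal !fctE /=.
(* All values at [s] become free variables, tied by [w ^+ 2 = k ^+ 2 + t ^+ 2]. The N terms cancel,
   and the difference of the two sides is an explicit multiple of this relation. *)
move: w0 w2 {k0 dk dt}.
move: (omega s) (kappa s) (tau s) (derive1 kappa s) (derive1 tau s).
move: (T s) (N s) (B s) => Ts Ns Bs w k t k' t' w0 w2.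
apply/rowP => i; rewrite !mxE; apply/eqP; rewrite -subr_eq0; apply/eqP.
rewrite [LHS](_ : _ = (w ^+ 2 - (k ^+ 2 + t ^+ 2)) * w ^- 3 *
  (t' * Ts 0 i + k' * Bs 0 i)); last by field; rewrite gt_eqF.
by rewrite w2 subrr !mul0r.
Qed.

Lemma is_derive_conormal s : I s ->
  is_derive s 1 E (theta' s *: D s - omega s *: N s).
Proof.
move=> Is; have w0 := darboux_norm_gt0 Is; have k0 := curvature_gt0 Is.
have dk := smooth_is_derive smooth_curvature Is.
have dt := smooth_is_derive smooth_torsion Is.
have w2 := darboux_norm_sqr Is.
apply: is_derive_eq (leibniz_scale (is_derive_inv_norm Is)
  (is_deriveD (leibniz_scale (is_deriveN dk) (is_derive_tangent Is))
              (leibniz_scale dt (is_derive_binormal Is)))) _.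
rewrite angle_speedE// /unit_darboux -/(omega s) !fctE /=.
move: w0 w2 {k0 dk dt}.
move: (omega s) (kappa s) (tau s) (derive1 kappa s) (derive1 tau s).
move: (T s) (N s) (B s) => Ts Ns Bs w k t k' t' w0 w2.
apply/rowP => i; rewrite !mxE; apply/eqP; rewrite -subr_eq0; apply/eqP.
(* Same reduction, with one more term: the Frenet equations give N the coefficient
   [- (k ^+ 2 + t ^+ 2) / w], against the expected [- w]. *)
rewrite [LHS](_ : _ = (w ^+ 2 - (k ^+ 2 + t ^+ 2)) * w ^- 3 *
  (t' * Bs 0 i - k' * Ts 0 i + w ^+ 2 * Ns 0 i)); last by field; rewrite gt_eqF.
by rewrite w2 subrr !mul0r.
Qed.

Lemma dot_darboux_darboux s : I s -> dot (D s) (D s) = 1.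
Proof.
move=> Is; have w0 := darboux_norm_gt0 Is.
have tt := dot_tangent_tangent Is; have nn := dot_normal_normal Is.
have tn := dot_tangent_normal Is.
rewrite !dot_linear (dotC (B s)) tt (frame_dot_bb tt nn tn) frame_dot_tb.
rewrite -/(omega s) [LHS](_ : _ = (kappa s ^+ 2 + tau s ^+ 2) / omega s ^+ 2).
  by rewrite -darboux_norm_sqr// divff// expf_neq0// gt_eqF.
by field; rewrite gt_eqF.
Qed.

Lemma dot_darboux_normal s : I s -> dot (D s) (N s) = 0.
Proof.
move=> Is; rewrite dotZl dotDl [dot (_ *: T s) _]dotZl [dot (_ *: B s) _]dotZl.
by rewrite dot_tangent_normal// (dotC (B s)) frame_dot_nb !mulr0 addr0 mulr0.
Qed.

Lemma cross_darboux_normal s : I s -> cross (D s) (N s) = E s.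
Proof.
move=> Is.
have tt := dot_tangent_tangent Is; have nn := dot_normal_normal Is.
have tn := dot_tangent_normal Is.
rewrite crossC !(crossZr, crossDr) (frame_cross_nb nn tn) (crossC (N s)).
by rewrite -scalerN; congr (_ *: _); rewrite opprD scalerN opprK addrC scaleNr.
Qed.

End FrenetFrame.

(** Used to restrict a property that holds near a point of the parameter plane to the parameter line
    through it. *)
Lemma continuous_s_curve (R : realType) (v : R) : continuous (s_curve v).
Proof. by move=> s; exact (cvg_pair (@cvg_id _ (nbhs s)) (cvg_cst v)). Qed.

Lemma continuous_v_curve (R : realType) (s : R) : continuous (v_curve s).
Proof. by move=> v; exact (cvg_pair (cvg_cst s) (@cvg_id _ (nbhs v))). Qed.

(** * The ruled surface D + v N of an abstract rotating orthonormal frame (D, N, E) *)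

Section DarbouxSurface.
Variables (R : realType) (I : set R) (D N E : R -> 'rV[R]_3) (w th : R -> R).
Hypotheses (openI : open I) (w_gt0 : forall s, I s -> 0 < w s).
Hypotheses (smooth_w : smooth I w) (smooth_th : smooth I th).
Hypothesis dD : forall s, I s -> is_derive s 1 D (- th s *: E s).
Hypothesis dN : forall s, I s -> is_derive s 1 N (w s *: E s).
Hypothesis dE : forall s, I s -> is_derive s 1 E (th s *: D s - w s *: N s).
Hypothesis DD : forall s, I s -> dot (D s) (D s) = 1.
Hypothesis NN : forall s, I s -> dot (N s) (N s) = 1.
Hypothesis DN : forall s, I s -> dot (D s) (N s) = 0.
Hypothesis DxN : forall s, I s -> cross (D s) (N s) = E s.

Let K (p : R * R) := D p.1 + p.2 *: N p.1.
(** Signed speed of the s-curve in the direction E, equal to [omega (v - sigma)] for the Darboux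
    frame. Its zeros are the singular points of the surface. *)
Let speed (v s : R) := v * w s - th s.

Variable U : R * R -> 'rV[R]_3.
Hypothesis normalU : unit_normal_on I K U.

Let EE s : I s -> dot (E s) (E s) = 1.
Proof. by move=> Is; rewrite -DxN// frame_dot_bb// ?DD ?NN ?DN. Qed.

Let DE s : I s -> dot (D s) (E s) = 0.
Proof. by move=> Is; rewrite -DxN// frame_dot_tb. Qed.

Let ExN s : I s -> cross (E s) (N s) = - D s.
Proof. by move=> Is; rewrite crossC -DxN// frame_cross_nb// ?DD ?NN ?DN. Qed.

Let DxE s : I s -> cross (D s) (E s) = - N s.
Proof. by move=> Is; rewrite -DxN// frame_cross_tb// ?DD ?NN ?DN. Qed.

Lemma is_derive_s_curve v s : I s ->
  is_derive s 1 (K \o s_curve v) (speed v s *: E s).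
Proof.
move=> Is; apply: is_derive_eq (is_deriveD (dD Is) (is_deriveZ v (dN Is))) _.
by rewrite scalerA -scalerDl addrC.
Qed.

Lemma derive1_s_curve v s : I s ->
  derive1 (K \o s_curve v) s = speed v s *: E s.
Proof. by move=> /(is_derive_s_curve v)/is_derive1E. Qed.

Lemma derive1_v_curve s v : derive1 (K \o v_curve s) v = N s.
Proof.
apply: is_derive1E.
apply: is_derive_eq (is_deriveD (is_derive_cst (D s) v 1)
  (leibniz_scale (is_derive_id v 1) (is_derive_cst (N s) v 1))) _.
by rewrite scale1r scaler0 addr0 add0r.
Qed.

Lemma partial_sE p : I p.1 -> partial_s K p = speed p.2 p.1 *: E p.1.
Proof. by move=> Ip; exact: derive1_s_curve. Qed.

Lemma partial_vE p : partial_v K p = N p.1.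
Proof. exact: derive1_v_curve. Qed.

Lemma derive2_s_curve v s : I s -> derive1n 2 (K \o s_curve v) s =
  (v * derive1 w s - derive1 th s) *: E s
  + speed v s *: (th s *: D s - w s *: N s).
Proof.
move=> Is; rewrite derive1nS.
(* The formula for the first derivative is known only on [I]; it may be differentiated because [I]
   is open. *)
rewrite (derive1_eq_on openI (fun r Ir => derive1_s_curve v Ir) Is).
have dw := smooth_is_derive smooth_w Is.
have dth := smooth_is_derive smooth_th Is.
by rewrite (is_derive1E (leibniz_scale (is_deriveB (is_deriveZ v dw) dth) (dE Is))).
Qed.

Lemma normal_vectorE p : I p.1 -> normal_vector K p = - speed p.2 p.1 *: D p.1.
Proof.
move=> Ip; rewrite /normal_vector partial_sE// partial_vE.
by rewrite crossZl ExN// scalerN scaleNr.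
Qed.

(** Where [speed] is nonzero, normalizing [- speed *: D] leaves D up to the sign of [speed], so U is
    D or - D. *)
Lemma unit_normal_dot_regular p : I p.1 -> speed p.2 p.1 != 0 ->
  dot (U p) (D p.1) ^+ 2 = 1.
Proof.
move=> Ip sp; have [_ _] := normalU Ip.
have D1 : enorm (D p.1) = 1 by exact/enorm_eq1/DD.
have D0 : D p.1 != 0.
  by apply/eqP => D0; have := DD Ip; rewrite D0 dot0l => /eqP; rewrite eq_sym oner_eq0.
rewrite normal_vectorE// scaler_eq0 oppr_eq0 (negbTE sp) (negbTE D0) => /(_ isT).
rewrite /gauss_normal normal_vectorE// enormZ D1 mulr1 normrN.
have sp2 : (`|speed p.2 p.1|^-1 * speed p.2 p.1) ^+ 2 = 1.
  by rewrite exprMn exprVn real_normK ?num_real// mulVf// expf_neq0.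
by case=> ->; rewrite ?dotNl !dotZl DD// mulr1 mulrN ?opprK ?sqrrN.
Qed.

Lemma continuous_dot (X : topologicalType) (F G : X -> 'rV[R]_3) x :
  {for x, continuous F} -> {for x, continuous G} ->
  {for x, continuous (fun y => dot (F y) (G y))}.
Proof.
move=> cF cG; rewrite [X in {for _, continuous X}](_ : _ = fun y =>
  F y 0 0 * G y 0 0 + F y 0 1 * G y 0 1 + F y 0 2 * G y 0 2); last first.
  by apply/funext => y; exact: dotE.
have cc (H : X -> 'rV[R]_3) i :
    {for x, continuous H} -> {for x, continuous (fun y => H y 0 i)}.
  by move=> cH; exact (continuous_comp cH (@coord_continuous R 1 3 0 i (H x))).
have cM i : {for x, continuous (fun y => F y 0 i * G y 0 i)}.
  exact (continuousM (cc F i cF) (cc G i cG)).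
exact (continuousD (continuousD (cM 0) (cM 1)) (cM 2)).
Qed.

(* At a singular point [K_s x K_v = 0] the claim follows from the regular
   points nearby on the same ruling. *)
Lemma unit_normal_dot p : I p.1 -> dot (U p) (D p.1) ^+ 2 = 1.
Proof.
case: p => s v /= Is.
have cU : {for v, continuous (fun x => U (s, x))}.
  have [cU _ _] := normalU (p := (s, v)) Is.
  exact (continuous_comp (@continuous_v_curve R s v) cU).
have cf : {for v, continuous (fun x => dot (U (s, x)) (D s) ^+ 2)}.
  have cd := continuous_dot cU (@cst_continuous _ _ (D s) v).
  exact (continuousM cd cd).
have [|sp] := eqVneq (speed v s) 0; last exact: unit_normal_dot_regular.
move=> sp0.
have cf' := (continuous_withinNx _ _).1 cf.
have near1 : \forall x \near v^', dot (U (s, x)) (D s) ^+ 2 = 1.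
  near=> x; rewrite (unit_normal_dot_regular (p := (s, x)))//=.
  (* [speed] is affine along the ruling with slope [w s > 0], so [v] is its only zero there. *)
  have : x != v by near: x; exact: nbhs_dnbhs_neq.
  apply: contra_neq => spx; apply: (mulIf (lt0r_neq0 (w_gt0 Is))).
  by apply/eqP; rewrite -subr_eq0; move: spx sp0; rewrite /speed => spx sp0;
    apply/eqP; lra.
exact (norm_cvg_unique cf' (cvg_near_cst _ near1)).
Unshelve. all: by end_near. Qed.

Lemma unit_normalE p : I p.1 -> U p = dot (U p) (D p.1) *: D p.1.
Proof.
move=> Ip; have [_ /enorm_eq1 U1 _] := normalU Ip.
by apply: unit_collinear (DD Ip) (unit_normal_dot Ip).
Qed.

(* The sign of [U] with respect to [D] is continuous, hence locally constant. *)
Lemma unit_normal_near p : I p.1 ->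
  \forall q \near p, U q = dot (U p) (D p.1) *: D q.1.
Proof.
move=> Ip; have [cU _ _] := normalU Ip.
pose f q := dot (U q) (D q.1).
have cD : {for p, continuous (fun q : R * R => D q.1)}.
  apply: continuous_comp; first exact: cvg_fst.
  by apply/differentiable_continuous/derivable1_diffP; case: (dD Ip).
have cf : {for p, continuous f} by exact: continuous_dot.
have f1 q : I q.1 -> f q = 1 \/ f q = - 1.
  by move=> /unit_normal_dot/eqP; rewrite sqrf_eq1 => /orP[]/eqP; [left|right].
have fp : 0 < f p * f p by rewrite -expr2 unit_normal_dot.
(* Both factors are 1 or -1, so a positive product forces [f q = f p]. *)
have ff : \forall q \near p, 0 < f p * f q.
  have cff := continuousM (@cst_continuous _ _ (f p) p) cf.
  exact: (cvgr_gt _ cff _ fp).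
have Iq : \forall q \near p, I q.1.
  have cfst : {for p, continuous (@fst R R)} by exact: cvg_fst.
  by apply: cfst; exact: open_nbhs_nbhs.
near=> q; have Iq1 : I q.1 by near: q.
rewrite [LHS]unit_normalE//; congr (_ *: _).
have : 0 < f p * f q by near: q.
rewrite -/(f q) -/(f p).
by case: (f1 p Ip) => ->; case: (f1 q Iq1) => ->//; lra.
Unshelve. all: by end_near. Qed.

(** Near the point U is [e *: D] with a fixed sign [e], so [S(K_s) = - U_s = e th E], while
    [K_s = speed E]: both are multiples of E. At a singular point [K_s = 0], and the coefficients 0
    and 1 give the relation. *)
Lemma line_of_curvature_s_curve v : line_of_curvature I K U (s_curve v).
Proof.
move=> s Is.
rewrite (_ : fst \o s_curve v = id)// (_ : snd \o s_curve v = cst v)//.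
rewrite derive1_id derive1_cst /= /shape_operator /tangent_map /=.
rewrite !scale1r !scale0r !addr0 partial_sE// /partial_s /=.
have dU : is_derive s 1 (fun r => U (r, v))
    (dot (U (s, v)) (D s) *: (- th s *: E s)).
  apply: near_eq_is_derive (is_deriveZ _ (dD Is)).
  have nU : \forall r \near s, U (r, v) = dot (U (s, v)) (D s) *: D r.
    exact (continuous_s_curve (unit_normal_near (p := (s, v)) Is)).
  by apply: filterS nU => r ->.
rewrite (is_derive1E dU) /linearly_dependent.
set e := dot _ _.
have [sp|sp] := eqVneq (speed v s) 0.
  exists 0, 1; split; first by rewrite xpair_eqE oner_eq0 andbF.
  by rewrite sp !scale0r scaler0 addr0.
exists (speed v s), (- (e * th s)); split.
  by rewrite xpair_eqE (negbTE sp).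
by rewrite -scaleNr !scalerA -scalerDl; apply/eqP; rewrite scaler_eq0;
  apply/orP; left; apply/eqP; ring.
Qed.

(** D is constant along a ruling, hence so is U locally, and [S(K_v) = 0]. *)
Lemma line_of_curvature_v_curve s : I s -> line_of_curvature setT K U (v_curve s).
Proof.
move=> Is v _.
rewrite (_ : fst \o v_curve s = cst s)// (_ : snd \o v_curve s = id)//.
rewrite derive1_id derive1_cst /= /shape_operator /tangent_map /=.
rewrite !scale1r !scale0r !add0r partial_vE /partial_v /=.
have dU : is_derive v 1 (fun r => U (s, r)) 0.
  apply: near_eq_is_derive (is_derive_cst (dot (U (s, v)) (D s) *: D s) v 1).
  have nU : \forall r \near v, U (s, r) = dot (U (s, v)) (D s) *: D s.
    exact (continuous_v_curve (unit_normal_near (p := (s, v)) Is)).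
  by apply: filterS nU => r ->.
rewrite (is_derive1E dU); exists 1, 0; split.
  by rewrite xpair_eqE oner_eq0.
by rewrite oppr0 scaler0 scale0r addr0.
Qed.

(** Only the D component of [K_ss] meets U, and the factor [<U, D>] has square 1, so it can be
    cancelled. *)
Lemma asymptotic_s_curve v : asymptotic_curve I K U (s_curve v) <->
  forall s, I s -> th s * speed v s = 0.
Proof.
have UKss s : I s -> dot (U (s, v)) (derive1n 2 (K \o s_curve v) s) =
    dot (U (s, v)) (D s) * (th s * speed v s).
  move=> Is; rewrite derive2_s_curve// [in LHS](unit_normalE (p := (s, v)) Is) /=.
  set e := dot _ (D s); rewrite !dot_linear DE// DD// DN//; ring.
split=> h s Is; last by rewrite UKss// h// mulr0.
have := h s Is; rewrite /s_curve UKss// => /eqP; rewrite mulf_eq0 => /orP[|/eqP//].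
move=> /eqP U0; have := unit_normal_dot (p := (s, v)) Is.
by rewrite /= U0 expr0n => /eqP; rewrite eq_sym oner_eq0.
Qed.

(** If [speed] vanishes on [I], the s-curve has zero velocity there and hence zero acceleration.
    Conversely, the E component of [U x K_ss] is [- <U, D> w speed], where only [speed] can
    vanish. *)
Lemma geodesic_s_curve v : geodesic_curve I K U (s_curve v) <->
  forall s, I s -> speed v s = 0.
Proof.
split=> h s Is; last first.
  rewrite derive1nS derive1n1 (@derive1_eq_on _ _ openI _ _ (cst 0) _ _ Is).
    by rewrite derive1_cst cross0r.
  by move=> r Ir; rewrite derive1_s_curve// h// scale0r.
have := h s Is; rewrite derive2_s_curve// (unit_normalE (p := (s, v)) Is) /=.
set e := dot _ (D s) => UKss.
have e0 : e != 0.
  apply/eqP => e0; have := unit_normal_dot (p := (s, v)) Is.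
  by rewrite /= -/e e0 expr0n => /eqP; rewrite eq_sym oner_eq0.
have NE : dot (N s) (E s) = 0 by rewrite -DxN// frame_dot_nb.
(* Pairing with E removes the contributions of [D x E = - N] and [D x D = 0] and keeps that of
   [D x N = E]. *)
have := congr1 (dot (E s)) UKss.
rewrite crossZl !(crossDr, crossZr) -scaleNr crossZr.
rewrite DxE// DxN// crossvv !dot_linear.
rewrite EE// (dotC (E s)) NE (_ : dot (E s) 0 = 0); last by rewrite dotC dot0l.
rewrite !mulr0 mulr1 oppr0 !mulr0 !add0r => /eqP.
rewrite !mulf_eq0 (negbTE e0) oppr_eq0 (gt_eqF (w_gt0 Is)) orbF => /eqP //.
Qed.

Lemma straight_line_v_curve s : I s -> straight_line (K \o v_curve s).
Proof.
move=> Is; exists (D s), (N s); split.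
  apply/eqP => N0; have := NN Is.
  by rewrite N0 dot0l => /eqP; rewrite eq_sym oner_eq0.
by apply/seteqP; split => _ [t _ <-]; exists t.
Qed.

End DarbouxSurface.

(** * Constancy arguments on an interval *)

Lemma derive_zero_cst (R : realType) (I : set R) (f : R -> R) :
  is_interval I -> (forall s, I s -> is_derive s 1 f 0) ->
  forall s t, I s -> I t -> f s = f t.
Proof.
move=> itvI df; have le_cst s t : s <= t -> I s -> I t -> f s = f t.
  move=> st Is It; have Ist r : s <= r <= t -> I r by exact: itvI.
  (* Mean value theorem on the segment from [s] to [t], which lies in [I] because [I] is an
     interval. *)
  have [|||c _] := @MVT_segment R f (cst 0) s t.
  - by [].
  - by move=> r; rewrite in_itv/= => /andP[sr rt]; apply/df/Ist; rewrite !ltW.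
  - apply: continuous_in_subspaceT => r; rewrite inE/= in_itv/= => /Ist/df[dfr _].
    exact/differentiable_continuous/derivable1_diffP.
  - by rewrite mul0r => /eqP; rewrite subr_eq0 => /eqP.
by move=> s t Is It; have [/le_cst|/ltW/le_cst h] := leP s t; [exact|exact/esym/h].
Qed.

(** If both 0 and a nonzero [v] were attained, the connected image of [I] would contain [v / 2],
    which is neither value. *)
Lemma two_valued_cst (R : realType) (I : set R) (f : R -> R) v :
  is_interval I -> (forall s, I s -> {for s, continuous f}) ->
  (forall s, I s -> f s = 0 \/ f s = v) ->
  (forall s, I s -> f s = 0) \/ (forall s, I s -> f s = v).
Proof.
move=> itvI cf f0v; have [//|/existsNP[s /not_implyP[Is fs]]] :=
  pselect (forall s, I s -> f s = 0); first by left.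
right=> t It; have [ft|//] := f0v t It.
have itvf : is_interval (f @` I).
  apply/connected_intervalP/connected_continuous_connected.
    exact/connected_intervalP.
  by apply: continuous_in_subspaceT => r; rewrite inE => /cf.
have [//|fsv] := f0v s Is.
have v0 : v != 0 by rewrite -fsv; exact/eqP.
have [r Ir fr] : (f @` I) (v / 2).
  have [v_lt0|v_gt0|v_eq0] := ltgtP v 0; last by rewrite v_eq0 eqxx in v0.
  - by apply: (itvf v 0); [exists s|exists t|apply/andP; split; lra].
  - by apply: (itvf 0 v); [exists t|exists s|apply/andP; split; lra].
by have [] := f0v r Ir; rewrite fr => h; move: v0; rewrite (_ : v = 0) ?eqxx//; lra.
Qed.

(** * Helix conditions expressed through sigma *)

Section Helices.
Variables (R : realType) (I : set R) (alpha : R -> 'rV[R]_3).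
Hypotheses (openI : open I) (itvI : is_interval I)
  (smooth_alpha : smooth_on I alpha)
  (curvature_neq0 : forall s, I s -> curvature alpha s != 0).

Let sigma_continuous s : I s -> {for s, continuous (slant_sigma alpha)}.
Proof.
move=> Is; have w0 r : I r -> darboux_norm alpha r != 0.
  by move=> Ir; rewrite gt_eqF// (darboux_norm_gt0 curvature_neq0 Ir).
have ssig := smoothM openI (smooth_angle_speed openI smooth_alpha curvature_neq0)
  (smoothV openI w0 (smooth_darboux_norm openI smooth_alpha curvature_neq0)).
apply: smooth_continuous Is.
by apply: smooth_eq_on ssig => // r Ir; rewrite (slant_sigmaE curvature_neq0 Ir).
Qed.

(** Since [sigma = theta' / omega], the condition [sigma = v] picks out the singular points of the
    surface on the s-curve at height [v]. *)
Lemma slant_sigma_eq s v : I s ->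
  slant_sigma alpha s = v <->
  v * darboux_norm alpha s - darboux_angle_speed alpha s = 0.
Proof.
move=> Is; have w0 := darboux_norm_gt0 curvature_neq0 Is.
rewrite (slant_sigmaE curvature_neq0 Is); split=> [<-|/eqP]; first by field; rewrite gt_eqF.
by rewrite subr_eq0 => /eqP <-; rewrite mulfK// gt_eqF.
Qed.

(** The factor in front of [(tau / kappa)'] in sigma is positive, so [sigma = 0] means that the
    ratio has zero derivative, and [I] is an interval. *)
Lemma general_helixP :
  general_helix I alpha <-> forall s, I s -> slant_sigma alpha s = 0.
Proof.
have sr := smooth_ratio openI smooth_alpha curvature_neq0.
split=> [[c hc] s Is|sig0].
  rewrite /slant_sigma (@derive1_eq_on _ _ openI _ _ (cst c) s)//.
  by rewrite derive1_cst mulr0.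
have dr s : I s -> is_derive s 1 (fun r => torsion alpha r / curvature alpha r) 0.
  move=> Is; apply: is_derive_eq (smooth_is_derive sr Is) _.
  have k0 := curvature_gt0 curvature_neq0 Is.
  have /eqP := sig0 s Is; rewrite /slant_sigma mulf_eq0 => /orP[|/eqP//].
  rewrite gt_eqF// divr_gt0 ?exprn_gt0// powR_gt0//.
  exact: (darboux_sqr_gt0 curvature_neq0 Is).
(* The constant is the ratio at any point of [I]; if [I] is empty, 0 serves. *)
have [[s0 Is0]|nI] := pselect (exists s, I s); last first.
  by exists 0 => s Is; case: nI; exists s.
exists (torsion alpha s0 / curvature alpha s0) => s Is.
exact: derive_zero_cst dr _ _ Is Is0.
Qed.

Lemma asymptotic_conditionP v :
  (forall s, I s -> darboux_angle_speed alpha s *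
     (v * darboux_norm alpha s - darboux_angle_speed alpha s) = 0) <->
  general_helix I alpha \/ slant_helix_of_constant I alpha v.
Proof.
have s0 s : I s -> darboux_angle_speed alpha s = 0 <-> slant_sigma alpha s = 0.
  move=> Is; rewrite slant_sigma_eq// mul0r sub0r.
  by split=> [->|/eqP]; rewrite ?oppr0// oppr_eq0 => /eqP.
split=> [h|[/general_helixP h|h] s Is].
(* Which factor vanishes may a priori depend on [s]; continuity of sigma makes the choice uniform on
   [I]. *)
- rewrite general_helixP; apply: (two_valued_cst itvI sigma_continuous) => s Is.
  have /eqP := h s Is; rewrite mulf_eq0 => /orP[]/eqP.
    by move=> /(s0 s Is); left.
  by move=> /(slant_sigma_eq v Is); right.
- by have /(s0 s Is) -> := h s Is; rewrite mul0r.
- by have /(slant_sigma_eq v Is) -> := h s Is; rewrite mulr0.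
Qed.

(** A plane curve is a general helix with ratio 0, hence has [sigma = 0]. This absorbs the plane
    case of (ii) into the slant case. *)
Lemma plane_curve_slant : plane_curve I alpha -> slant_helix_of_constant I alpha 0.
Proof. by move=> pl; apply/general_helixP; exists 0 => s Is; rewrite pl// mul0r. Qed.

End Helices.

(** Claims (i) and (ii) are given in two readings. For a fixed [v] the constant of the slant helix
    is [v] itself; when [v] is quantified existentially, the constant is free. *)
Theorem theorem10 (R : realType) (I : set R) (alpha : R -> 'rV[R]_3)
    (U : R * R -> 'rV[R]_3) :
  open I -> is_interval I ->
  smooth_on I alpha -> unit_speed_on I alpha ->
  (forall s, I s -> curvature alpha s != 0) ->
  let K := darboux_developable alpha in
  unit_normal_on I K U ->
  (* (i) *)
  ((forall v, asymptotic_curve I K U (s_curve v) <->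
      general_helix I alpha \/ slant_helix_of_constant I alpha v) /\
   ((exists v, asymptotic_curve I K U (s_curve v)) <->
      general_helix I alpha \/ slant_helix I alpha)) /\
  (* (ii) *)
  ((forall v, geodesic_curve I K U (s_curve v) <->
      (plane_curve I alpha /\ v = 0) \/ slant_helix_of_constant I alpha v) /\
   ((exists v, geodesic_curve I K U (s_curve v)) <->
      plane_curve I alpha \/ slant_helix I alpha)) /\
  (* (iii) *)
  (forall s, I s -> straight_line (K \o v_curve s)) /\
  (* (iv) *)
  ((forall v, line_of_curvature I K U (s_curve v)) /\
   (forall s, I s -> line_of_curvature setT K U (v_curve s))).
Proof.
move=> openI itvI sa us k0 K normalU.
(* The Darboux frame of [alpha] meets the assumptions on the abstract frame, with [w = omega] and
   [th = theta']. *)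
have w0 := @darboux_norm_gt0 R I alpha k0.
have sw := smooth_darboux_norm openI sa k0.
have sth := smooth_angle_speed openI sa k0.
have dD := @is_derive_darboux R I alpha openI sa us k0.
have dN := @is_derive_normal_darboux R I alpha openI sa us k0.
have dE := @is_derive_conormal R I alpha openI sa us k0.
have DD := @dot_darboux_darboux R I alpha openI sa us k0.
have NN := @dot_normal_normal R I alpha k0.
have DN := @dot_darboux_normal R I alpha openI sa us k0.
have DxN := @cross_darboux_normal R I alpha openI sa us k0.
have asym v : asymptotic_curve I K U (s_curve v) <->
    general_helix I alpha \/ slant_helix_of_constant I alpha v.
  apply: iff_trans (asymptotic_conditionP openI itvI sa k0 v).
  exact (asymptotic_s_curve openI w0 sw sth dD dN dE DD NN DN DxN normalU v).
have slant v : geodesic_curve I K U (s_curve v) <->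
    slant_helix_of_constant I alpha v.
  apply: iff_trans (geodesic_s_curve openI w0 sw sth dD dN dE DD NN DN DxN normalU v) _.
  by split=> h s Is; apply/(slant_sigma_eq k0 v Is)/h.
have plane := @plane_curve_slant R I alpha openI itvI sa k0.
split; [split|split; [split|split; [|split]]].
- exact: asym.
- split=> [[v /asym[]]|[gh|[v sv]]]; first by left.
  + by right; exists v.
  (* For a general helix every [v] works, and 0 is an arbitrary choice. *)
  + by exists 0; apply/asym; left.
  + by exists v; apply/asym; right.
- move=> v; split=> [/slant|[[/plane ? ->]|?]]; [by right|exact/slant|exact/slant].
- split=> [[v /slant sv]|[/plane|[v]] sv]; first by right; exists v.
  + by exists 0; exact/slant.
  + by exists v; exact/slant.
- by move=> s Is; exact (straight_line_v_curve (unit_darboux alpha) NN Is).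
- exact (line_of_curvature_s_curve openI w0 dD dN DD NN DN DxN normalU).
- exact (fun s Is => line_of_curvature_v_curve openI w0 dD dN DD NN DN DxN normalU Is).
Qed.
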